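(* Let $A,u_0,\hat b,\hat u,t$, $z_l,z_r,d,r$, $a>0$, $a_1,a_2$ and $z(x)$ be as in the context, let $c\in(0,1/2)$ and let $N\ge1$ be an integer. Let $x_j=-c\pi+j\frac{2c\pi}{N}$, $j=1,\dots,N-1$, assume $\hat u$ is defined at the points $z(x_j)$, and let $$I_N=\frac{c}{N\mathrm{i}}\sum_{j=1}^{N-1}e^{z(x_j)t}\,\hat u(z(x_j))\,z'(x_j),\qquad \tilde I_N=\frac{c}{N\mathrm{i}}\sum_{j=1}^{N-1}e^{z(x_j)t}\,\hat u_j\,z'(x_j),\qquad \hat u_j=\hat u(z(x_j))+\rho_j,$$ where $\rho_j\in\mathbb{C}^n$ are arbitrary (the errors in the numerical solution of the linear systems $(z(x_j)I-A)\hat u=u_0+\hat b(z(x_j))$, the quantities $x_j,z(x_j),z'(x_j)$ being computed exactly). Then the method is numerically stable with stability constant $2a_2c\,e^{(a_1+a_2+z_l)t}$, that is, $$\|I_N-\tilde I_N\|\le 2a_2c\,e^{(a_1+a_2+z_l)t}\,\max_{1\le j\le N-1}\|\rho_j\| .$$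
   Context: $A\in\mathbb{R}^{n\times n}$, $u_0\in\mathbb{R}^n$, $\hat b$ is (an analytic extension of) the Laplace transform of a source term $b$, and $\hat u(z)=(zI-A)^{-1}(u_0+\hat b(z))$ with $I$ the identity matrix. $t>0$ is fixed and $\|\cdot\|$ is a norm on $\mathbb{C}^n$. The parameters $z_l<z_r$ are real, $d\in[z_l,z_r)$, $r>0$, $\tilde w=\arccos\left(\frac{d-z_l}{z_r-z_l}\right)$, and for given $a>0$ $$a_1=\frac{e^{-a}}{2}\left(z_r-z_l-\frac{r}{\sin\tilde w}\right),\qquad a_2=\frac{e^{a}}{2}\left(z_r-z_l+\frac{r}{\sin\tilde w}\right).$$ The integration ellipse is parameterized by $z(x)=(a_1+a_2)\cos x+\mathrm{i}(a_2-a_1)\sin x+z_l$. The sum $I_N$ is the method's trapezoidal approximation of the solution at time $t$ of $u'=Au+b$, $u(0)=u_0$, and $\tilde I_N$ is the sum actually computed when the linear systems are solved with errors $\rho_j$. For $N=1$ both sums are empty and the maximum is read as $0$. *)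

(* Defs.v *)
From HB Require Import structures.
From mathcomp Require Export all_boot all_order all_algebra.
From mathcomp Require Export all_classical all_reals all_analysis.
From mathcomp Require Export complex.

Set Implicit Arguments.
Unset Strict Implicit.
Unset Printing Implicit Defensive.

Export Order.TTheory GRing.Theory Num.Theory.
Export numFieldNormedType.Exports.

Local Open Scope classical_set_scope.
Local Open Scope ring_scope.
Local Open Scope complex_scope.

Section Complex.
Variable R : realType.
Implicit Types (z l : R[i]) (f : R -> R[i]).

Definition cexp z : R[i] :=
  (expR (complex.Re z) * cos (complex.Im z))
    +i* (expR (complex.Re z) * sin (complex.Im z)).

Definition cderive f (x : R) : R[i] :=
  (derive1 (fun y => complex.Re (f y)) x) +i* (derive1 (fun y => complex.Im (f y)) x).

Definition cintegrable (D : set R) f : Prop :=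
  (@lebesgue_measure R).-integrable D (fun x => (complex.Re (f x))%:E) /\
  (@lebesgue_measure R).-integrable D (fun x => (complex.Im (f x))%:E).

Definition cintegral (D : set R) f : R[i] :=
  (\int[@lebesgue_measure R]_(x in D) complex.Re (f x))
    +i* (\int[@lebesgue_measure R]_(x in D) complex.Im (f x)).

(* The integral over [0, +oo[ is the limit of the integrals over [0, T], so
   that merely conditionally convergent Laplace integrals are allowed. *)
Definition laplace_at f z l : Prop :=
  let g s := cexp (- (z * s%:C)) * f s in
  (forall T : R, cintegrable `[0, T] g) /\
  (fun T : R => complex.Re (cintegral `[0, T] g)) @ +oo --> complex.Re l /\
  (fun T : R => complex.Im (cintegral `[0, T] g)) @ +oo --> complex.Im l.

(* D is the domain of definition of bhat, whose values outside D are
   irrelevant; analyticity is complex differentiability on the open set D. *)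
Definition laplace_extension n (b : R -> 'cV[R[i]]_n)
    (D : set R[i]) (bhat : R[i] -> 'cV[R[i]]_n) : Prop :=
  [/\ open (D : set R[i]^o),
      forall z k, D z ->
        derivable ((fun w => bhat w k 0) : R[i]^o -> R[i]^o) z 1
    & exists sigma : R, forall z, sigma < complex.Re z ->
        D z /\ forall k, laplace_at (fun s => b s k 0) z (bhat z k 0)].

Record is_norm n (nu : 'cV[R[i]]_n -> R) : Prop := IsNorm {
  is_norm_ge0 : forall v, 0 <= nu v;
  is_norm_eq0 : forall v, nu v = 0 -> v = 0;
  is_normZ : forall (a : R[i]) v, nu (a *: v) = ComplexField.Normc.normc a * nu v;
  is_normD : forall v w, nu (v + w) <= nu v + nu w }.

End Complex.

Section Method.
Variable R : realType.
Variable n : nat.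

Definition resolvent_pencil (A : 'M[R]_n) (z : R[i]) : 'M[R[i]]_n :=
  z%:M - map_mx (real_complex R) A.

Definition uhat_dom (A : 'M[R]_n) (D : set R[i]) : set R[i] :=
  [set z | D z /\ resolvent_pencil A z \in unitmx].

Definition uhat (A : 'M[R]_n) (u0 : 'cV[R]_n) (bhat : R[i] -> 'cV[R[i]]_n)
    (z : R[i]) : 'cV[R[i]]_n :=
  invmx (resolvent_pencil A z) *m (map_mx (real_complex R) u0 + bhat z).

Definition wtilde (zl zr d : R) : R := acos ((d - zl) / (zr - zl)).

Definition ell_a1 (zl zr d r a : R) : R :=
  expR (- a) / 2 * (zr - zl - r / sin (wtilde zl zr d)).

Definition ell_a2 (zl zr d r a : R) : R :=
  expR a / 2 * (zr - zl + r / sin (wtilde zl zr d)).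

Definition ellipse (a1 a2 zl : R) (x : R) : R[i] :=
  ((a1 + a2) * cos x)%:C + 'i%C * ((a2 - a1) * sin x)%:C + zl%:C.

Definition node (c : R) (N j : nat) : R :=
  - (c * pi) + j%:R * (2 * c * pi / N%:R).

Definition trapezoid (z : R -> R[i]) (t c : R) (N : nat)
    (v : nat -> 'cV[R[i]]_n) : 'cV[R[i]]_n :=
  (c%:C / (N%:R * 'i%C)) *:
    \sum_(1 <= j < N)
      ((cexp (z (node c N j) * t%:C) * cderive z (node c N j)) *: v j).

End Method.

(* Main.v *)
(** Both sums are linear in the values of [u], so [I_N - tI_N] is minus the
    trapezoidal sum of the errors: at most [N] terms, each with weight of
    modulus [c / N] times [|exp (z t) z'|].  The exponential is bounded by its
    value at the rightmost point [a1 + a2 + zl] of the ellipse, since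
    [a1 + a2 >= 0], and [|z'|] by the larger semi-axis, which is at most
    [2 a2].  Both facts come from [|a1| <= a2]; [a1] itself may be negative. *)

Require Import Defs.
From mathcomp Require Import ring lra.

Set Implicit Arguments.
Unset Strict Implicit.
Unset Printing Implicit Defensive.

Local Open Scope classical_set_scope.
Local Open Scope ring_scope.

Section EllipseBounds.
Variable R : realType.
Implicit Types (a zl x : R).

Local Notation normc := (@ComplexField.Normc.normc R).

Lemma normc_ge0 (w : R[i]) : 0 <= normc w.
Proof. by case: w => x y; exact: sqrtr_ge0. Qed.

Lemma normc_real x : normc (real_complex R x) = `|x|.
Proof. by rewrite /= expr0n addr0 sqrtr_sqr. Qed.

Lemma normc_cexp (w : R[i]) : normc (cexp w) = expR (complex.Re w).
Proof.
case: w => x y; rewrite /cexp /=.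
have -> : (expR x * cos y) ^+ 2 + (expR x * sin y) ^+ 2
    = expR x ^+ 2 * (cos y ^+ 2 + sin y ^+ 2) by ring.
by rewrite cos2Dsin2 mulr1 sqrtr_sqr ger0_norm ?expR_ge0.
Qed.

(** [cexp] and [cderive] act through real and imaginary parts, so both later estimates start from
    this form. *)
Lemma ellipse_coord a1 a2 zl x : ellipse a1 a2 zl x =
  Complex ((a1 + a2) * cos x + zl) ((a2 - a1) * sin x).
Proof.
rewrite /ellipse; apply/eqP; rewrite eq_complex /=.
by apply/andP; split; apply/eqP; ring.
Qed.

Lemma cderive_ellipse a1 a2 zl x : cderive (ellipse a1 a2 zl) x =
  Complex (- ((a1 + a2) * sin x)) ((a2 - a1) * cos x).
Proof.
rewrite /cderive; congr Complex.
  under eq_fun do rewrite ellipse_coord /=.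
  by rewrite derive1E derive_val /GRing.scale /=; ring.
under eq_fun do rewrite ellipse_coord /=.
by rewrite derive1E derive_val /GRing.scale /=; ring.
Qed.

(** Both semi-axes [a1 + a2] and [a2 - a1] lie between 0 and [2 * a2], so the squared modulus can be
    compared term by term with [(2 * a2) ^+ 2 * (cos x ^+ 2 + sin x ^+ 2)]. *)
Lemma normc_cderive_ellipse a1 a2 zl x : `|a1| <= a2 ->
  normc (cderive (ellipse a1 a2 zl) x) <= 2 * a2.
Proof.
rewrite ler_norml => /andP[a2l a2u].
have a20 : 0 <= 2 * a2 by lra.
rewrite cderive_ellipse /= -(ger0_norm a20) -sqrtr_sqr ler_sqrt ?sqr_ge0//.
have -> : (2 * a2) ^+ 2 = (2 * a2) ^+ 2 * (cos x ^+ 2 + sin x ^+ 2).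
  by rewrite cos2Dsin2 mulr1.
rewrite sqrrN !exprMn mulrDr addrC.
have a1D : 0 <= a1 + a2 by lra.
have a1B : 0 <= a2 - a1 by lra.
by apply: lerD; apply: ler_wpM2r; rewrite ?sqr_ge0// -?exprMn ler_sqr ?nnegrE//; lra.
Qed.

Lemma normc_cexp_ellipse a1 a2 zl t x : 0 <= a1 + a2 -> 0 <= t ->
  normc (cexp (ellipse a1 a2 zl x * real_complex R t))
    <= expR ((a1 + a2 + zl) * t).
Proof.
move=> a12 t0; rewrite normc_cexp ellipse_coord /= mulr0 subr0 ler_expR.
by apply: ler_wpM2r => //; rewrite lerD2r ler_piMr// cos_le1.
Qed.

(** The quotient lies in [0, 1), so its arccosine lies strictly between 0 and [pi]; [d < zr]
    excludes the angle 0. *)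
Lemma sin_wtilde_gt0 (zl zr d : R) :
  zl < zr -> zl <= d -> d < zr -> 0 < sin (wtilde zl zr d).
Proof.
move=> zlr zld dzr; have zr0 : 0 < zr - zl by lra.
have q0 : 0 <= (d - zl) / (zr - zl) by rewrite divr_ge0//; lra.
have q1 : (d - zl) / (zr - zl) < 1 by rewrite ltr_pdivrMr//; lra.
rewrite sin_gt0_pi// /wtilde acos_gt0 ?acos_ltpi//; apply/andP; split; lra.
Qed.

(** Compare factor by factor: [expR (- a) <= expR a], and |L - q| <= L + q for the positive numbers
    L = [zr - zl] and q = [r / sin (wtilde zl zr d)]. *)
Lemma norm_ell_a1_le (zl zr d r a : R) :
  zl < zr -> zl <= d -> d < zr -> 0 < r -> 0 < a ->
  `|ell_a1 zl zr d r a| <= ell_a2 zl zr d r a.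
Proof.
move=> zlr zld dzr r0 a0.
have q0 : 0 < r / sin (wtilde zl zr d) by rewrite divr_gt0// sin_wtilde_gt0.
rewrite /ell_a1 /ell_a2 normrM ger0_norm ?divr_ge0 ?expR_ge0//.
apply: ler_pM; rewrite ?divr_ge0 ?expR_ge0//.
  by rewrite ler_pM2r ?invr_gt0// ler_expR; lra.
by rewrite ler_norml; apply/andP; split; lra.
Qed.

End EllipseBounds.

Section Stability.
Variables (R : realType) (n : nat).

Local Notation normc := (@ComplexField.Normc.normc R).

Lemma is_norm_sum_le (nu : 'cV[R[i]]_n -> R) (K : R) (s : seq nat) (g : nat -> R[i])
    (v : nat -> 'cV[R[i]]_n) :
  is_norm nu -> (forall j, normc (g j) <= K) ->
  nu (\sum_(j <- s) g j *: v j)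
    <= (size s)%:R * (K * \big[Num.max/0]_(j <- s) nu (v j)).
Proof.
(* The bound on [g] is assumed at every index, so index 0 gives [0 <= K] even when [s] is empty. *)
move=> nuP gK; have K0 : 0 <= K by apply: le_trans (gK 0); exact: normc_ge0.
have -> : (size s)%:R * (K * \big[Num.max/0]_(j <- s) nu (v j)) =
    \sum_(i <- s) (K * \big[Num.max/0]_(j <- s) nu (v j)).
  by rewrite big_const_seq count_predT iter_addr_0 mulr_natl.
apply: (@le_trans _ _ (\sum_(j <- s) nu (g j *: v j))).
  elim/big_ind2: _ => [|x1 x2 y1 y2 h1 h2|//].
    (* That [nu] vanishes at 0 comes from homogeneity with scalar 0. *)
    by rewrite -(scale0r 0) (is_normZ nuP) normc_real normr0 mul0r.
  by apply: le_trans (is_normD nuP _ _) _; rewrite lerD.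
rewrite big_seq [leRHS]big_seq; apply: ler_sum => j js.
rewrite (is_normZ nuP); apply: ler_pM => //; first exact: normc_ge0.
  exact: is_norm_ge0.
exact: le_bigmax_seq.
Qed.

Lemma trapezoidB (z : R -> R[i]) (t c : R) (N : nat)
    (v w : nat -> 'cV[R[i]]_n) :
  trapezoid z t c N v - trapezoid z t c N w =
    trapezoid z t c N (fun j => v j - w j).
Proof.
rewrite /trapezoid -scalerBr -sumrB; congr (_ *: _).
by apply: eq_bigr => j _; rewrite scalerBr.
Qed.

Lemma normc_weight (c : R) (N : nat) : 0 <= c ->
  normc (real_complex R c / (N%:R * 'i%C)) = c / N%:R.
Proof.
move=> c0; rewrite ComplexField.Normc.normcM normc_real ger0_norm//.
rewrite ComplexField.Normc.normcV ComplexField.Normc.normcM.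
have -> : normc 'i%C = 1 by rewrite /= expr0n add0r expr1n sqrtr1.
by rewrite mulr1 -(rmorph_nat (real_complex R)) normc_real normr_nat.
Qed.

Lemma trapezoid_norm_le (nu : 'cV[R[i]]_n -> R) (z : R -> R[i])
    (t c K : R) (N : nat) (v : nat -> 'cV[R[i]]_n) :
  is_norm nu -> 0 <= c ->
  (forall x, normc (cexp (z x * real_complex R t) * cderive z x) <= K) ->
  nu (trapezoid z t c N v) <= c * (K * \big[Num.max/0]_(1 <= j < N) nu (v j)).
Proof.
move=> nuP c0 zK; rewrite /trapezoid (is_normZ nuP) normc_weight//.
have K0 : 0 <= K by apply: le_trans (zK 0); exact: normc_ge0.
have M0 : 0 <= K * \big[Num.max/0]_(1 <= j < N) nu (v j).
  by rewrite mulr_ge0// bigmax_idl le_max lexx.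
(* For [N = 0] the weight is 0, since the inverse of 0 is 0 by convention. *)
case: N M0 => [|N] M0; first by rewrite invr0 mulr0 mul0r mulr_ge0.
rewrite -mulrA ler_wpM2l// mulrC ler_pdivrMr ?ltr0n//.
pose g j := cexp (z (node c N.+1 j) * real_complex R t) *
  cderive z (node c N.+1 j).
have gK j : normc (g j) <= K by exact: zK.
apply: le_trans (is_norm_sum_le (index_iota 1 N.+1) v nuP gK) _.
(* The sum has one term fewer than the denominator [N.+1] of the weight; this slack is given
   away. *)
by rewrite mulrC ler_wpM2l// size_iota ler_nat subn1.
Qed.

End Stability.

Theorem proposition1 (R : realType) (n : nat)
    (A : 'M[R]_n) (u0 : 'cV[R]_n)
    (b : R -> 'cV[R[i]]_n) (D : set R[i]) (bhat : R[i] -> 'cV[R[i]]_n)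
    (nu : 'cV[R[i]]_n -> R) (t zl zr d r a c : R) (N : nat)
    (rho : nat -> 'cV[R[i]]_n) :
  laplace_extension b D bhat ->
  is_norm nu ->
  0 < t ->
  zl < zr -> zl <= d -> d < zr -> 0 < r -> 0 < a ->
  0 < c -> c < 1 / 2 ->
  (1 <= N)%N ->
  let a1 := ell_a1 zl zr d r a in
  let a2 := ell_a2 zl zr d r a in
  let z := ellipse a1 a2 zl in
  let u := uhat A u0 bhat in
  (forall j : nat, (1 <= j < N)%N -> uhat_dom A D (z (node c N j))) ->
  let I_N := trapezoid z t c N (fun j => u (z (node c N j))) in
  let tI_N := trapezoid z t c N (fun j => u (z (node c N j)) + rho j) in
  nu (I_N - tI_N) <=
    2 * a2 * c * expR ((a1 + a2 + zl) * t) *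
      \big[Num.max/0]_(1 <= j < N) nu (rho j).
Proof.
move=> _ nuP t0 zlr zld dzr r0 a0 c0 _ _ a1 a2 z u _; cbv zeta.
have a1a2 : `|a1| <= a2 by exact: norm_ell_a1_le.
have a12 : 0 <= a1 + a2 by move: a1a2; rewrite ler_norml => /andP[]; lra.
have zK x : ComplexField.Normc.normc
    (cexp (z x * real_complex R t) * cderive z x)
      <= expR ((a1 + a2 + zl) * t) * (2 * a2).
  rewrite ComplexField.Normc.normcM; apply: ler_pM; rewrite ?normc_ge0//.
  - exact: normc_cexp_ellipse a12 (ltW t0).
  - exact: normc_cderive_ellipse.
(* Swapping the difference makes the summands [rho j] themselves; the sign left in front has modulus
   1 and disappears by homogeneity. *)
rewrite -opprB trapezoidB.
under eq_fun do rewrite addrC addKr.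
rewrite -scaleN1r (is_normZ nuP) -(rmorphN1 (real_complex R)) normc_real.
rewrite normrN1 mul1r.
apply: le_trans (trapezoid_norm_le N rho nuP (ltW c0) zK) _.
by rewrite le_eqVlt; apply/predU1P; left; ring.
Qed.
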